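(* Let $G$ be a finite, simple, non-abelian group. The homomorphism $\mathcal{GT}_1(G)\to\mathscr{S}(G)$ given by the action of $\mathrm{Out}(\overline{G})$ on $\mathscr{P}_c$ is an isomorphism.
   Context: For a finite group $G$, let $F_2=\langle x,y\rangle$ be free on two generators, $N_G$ the intersection of all normal subgroups $N$ of $F_2$ with $F_2/N\cong G$, and $\overline{G}=F_2/N_G$ (finite); images of $x,y$ are still denoted $x,y$. There are automorphisms $\theta,\delta$ of $\overline{G}$ with $\theta(x)=y$, $\theta(y)=x$ and $\delta(x)=y^{-1}x^{-1}$, $\delta(y)=y$. $\mathcal{GT}_1(G)$ is the image in $\mathrm{Out}(\overline{G})$ of the subgroup of all $\varphi\in\mathrm{Aut}(\overline{G})$ such that $\varphi(x)$ is conjugate to $x$ in $\overline{G}$ and the class of $\varphi$ in $\mathrm{Out}(\overline{G})$ commutes with those of $\theta$ and $\delta$. Let $\mathscr{P}$ be the set of pairs $(g,h)\in G\times G$ with $\langle g,h\rangle=G$, and $\mathscr{P}_c$ its quotient by simultaneous conjugation by $G$; write $[g,h]_c$ for the class of $(g,h)$. $\mathrm{Out}(G)$ acts freely on $\mathscr{P}_c$ by $\alpha\cdot[g,h]_c=[\alpha(g),\alpha(h)]_c$. Action of $\mathrm{Out}(\overline{G})$ on $\mathscr{P}_c$: choose representatives $(x_1,y_1),\dots,(x_r,y_r)$ of the orbits of $\mathrm{Aut}(G)$ on $\mathscr{P}$. Let $p_i\colon\overline{G}\to G$ be the homomorphism with $p_i(x)=x_i$, $p_i(y)=y_i$, and $K_i=\ker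 p_i$; the $K_i$ are exactly the normal subgroups of $\overline{G}$ with quotient isomorphic to $G$, without repetition. For $\varphi\in\mathrm{Aut}(\overline{G})$, define $\sigma\in S_r$ by $\varphi(K_i)=K_{\sigma(i)}$ and $\varphi_i\in\mathrm{Aut}(G)$ by $\varphi_i\circ p_i=p_{\sigma(i)}\circ\varphi$. Every element of $\mathscr{P}_c$ is uniquely $[\alpha(x_i),\alpha(y_i)]_c$ with $\alpha\in\mathrm{Out}(G)$, $1\le i\le r$, and the action is $$\varphi\cdot[\alpha(x_i),\alpha(y_i)]_c=[\alpha\varphi_i^{-1}(x_{\sigma(i)}),\alpha\varphi_i^{-1}(y_{\sigma(i)})]_c .$$ It factors through $\mathrm{Out}(\overline{G})$. One has $\theta\cdot[g,h]_c=[h,g]_c$ and $\delta\cdot[g,h]_c=[h^{-1}g^{-1},h]_c$. $\mathscr{S}(G)$ is the group of permutations of $\mathscr{P}_c$ which commute with the action of $\mathrm{Out}(G)$ and with the permutations induced by $\theta$ and $\delta$, and which preserve each class of the following equivalence relation on $\mathscr{P}_c$: $[a_1,b_1]_c$ and $[a_2,b_2]_c$ are related if $a_1$ is conjugate to $a_2$ and $b_1$ is conjugate to $b_2$ in $G$. For any finite $G$ the action maps $\mathcal{GT}_1(G)$ into $\mathscr{S}(G)$. *)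

(* Defs.v *)
From HB Require Import structures.
From mathcomp Require Import all_boot all_fingroup gseries.
From mathcomp Require Import boolp.

Set Implicit Arguments.
Unset Strict Implicit.
Unset Printing Implicit Defensive.

Local Open Scope group_scope.
Local Open Scope quotient_scope.

(* repr alone would denote the representative of a set in a finite group.     *)
Notation qrepr := generic_quotient.repr.

(* The free group on x and y, as reduced words.  The letter (b, s) is the     *)
(* generator x if b = false and y if b = true, inverted if s = true.          *)

Definition letter := (bool * bool)%type.
Definition linv (l : letter) : letter := (l.1, ~~ l.2).

Definition lcons (l : letter) (w : seq letter) : seq letter :=
  if w is m :: w' then (if m == linv l then w' else l :: w) else [:: l].

Definition reduced (w : seq letter) : bool :=
  sorted (fun l m => m != linv l) w.

Definition lmul (u v : seq letter) : seq letter := foldr lcons v u.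

Lemma linvK : involutive linv.
Proof. by case=> b s; rewrite /linv /= negbK. Qed.

Lemma reduced_cons l w : reduced (l :: w) -> reduced w.
Proof. by case: w => //= m w /andP[]. Qed.

Lemma lcons_reduced l w : reduced w -> reduced (lcons l w).
Proof.
case: w => //= m w rw; case: eqP => [_|/eqP ne] /=; last by rewrite ne.
exact: (@reduced_cons m).
Qed.

Lemma lconsK l w : reduced w -> lcons (linv l) (lcons l w) = w.
Proof.
case: w => [_|m w rw] /=; first by rewrite linvK eqxx.
case: eqP => [<-|_] /=; last by rewrite linvK eqxx.
by case: w rw => //= k w /andP[/negPf ->].
Qed.

Lemma lconsE l w : reduced (l :: w) -> lcons l w = l :: w.
Proof. by case: w => //= m w /andP[/negPf ->]. Qed.

Lemma lmul_reduced u v : reduced v -> reduced (lmul u v).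
Proof. by move=> rv; elim: u => //= l u; exact: lcons_reduced. Qed.

Lemma lmul_lcons l u v : reduced v -> lmul (lcons l u) v = lcons l (lmul u v).
Proof.
move=> rv; case: u => //= m u; case: eqP => // ->.
by rewrite -{1}(linvK l) lconsK // lmul_reduced.
Qed.

Lemma lmulA u v w : reduced w -> lmul u (lmul v w) = lmul (lmul u v) w.
Proof.
move=> rw; elim: u => //= l u IH.
by rewrite lmul_lcons // IH.
Qed.

Lemma lmul1 u : reduced u -> lmul u [::] = u.
Proof.
by elim: u => //= l u IH ru; rewrite IH ?lconsE //; apply: reduced_cons ru.
Qed.

Definition lrev (w : seq letter) : seq letter := rev (map linv w).

Lemma lrevK : involutive lrev.
Proof.
by move=> w; rewrite /lrev map_rev revK -map_comp map_id_in // => l _ /=; apply: linvK.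
Qed.

Lemma lrev_reduced w : reduced w -> reduced (lrev w).
Proof.
rewrite /reduced /lrev rev_sorted sorted_map; apply: sub_sorted => l m /=.
by apply: contra => /eqP->; rewrite linvK.
Qed.

Lemma lmul_cat u v w : lmul (u ++ v) w = lmul u (lmul v w).
Proof. by rewrite /lmul foldr_cat. Qed.

Lemma lmulV u w : reduced w -> lmul (lrev u) (lmul u w) = w.
Proof.
move=> rw; elim: u => //= l u IH.
rewrite /lrev /= rev_cons -cats1 lmul_cat /= lconsK ?IH //.
exact: lmul_reduced.
Qed.

Record F2 := FreeWord { fword :> seq letter; fwordP : reduced fword }.
HB.instance Definition _ := [isSub for fword].
HB.instance Definition _ := [Countable of F2 by <:].

Definition F2_one : F2 := @FreeWord [::] isT.
Definition F2_mul (u v : F2) : F2 := FreeWord (lmul_reduced u (fwordP v)).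
Definition F2_inv (u : F2) : F2 := FreeWord (lrev_reduced (fwordP u)).

Lemma F2_mulA : associative F2_mul.
Proof. by move=> u v w; apply/val_inj/lmulA/fwordP. Qed.
Lemma F2_mul1 : left_id F2_one F2_mul.
Proof. by move=> u; apply/val_inj. Qed.
Lemma F2_1mul : right_id F2_one F2_mul.
Proof. by move=> u; apply/val_inj/lmul1/fwordP. Qed.
Lemma F2_mulV : left_inverse F2_one F2_inv F2_mul.
Proof.
move=> u; apply/val_inj => /=.
by rewrite -[X in lmul _ X](lmul1 (fwordP u)) lmulV.
Qed.
Lemma F2_mulVr : right_inverse F2_one F2_inv F2_mul.
Proof.
move=> u; rewrite -[X in F2_mul X _](_ : F2_inv (F2_inv u) = u) ?F2_mulV //.
by apply/val_inj; rewrite /= lrevK.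
Qed.

HB.instance Definition _ := isGroup.Build F2
  F2_mulA F2_mul1 F2_1mul F2_mulV F2_mulVr.

Definition F2x : F2 := @FreeWord [:: (false, false)] isT.
Definition F2y : F2 := @FreeWord [:: (true, false)] isT.

(* The homomorphism from F2 sending x to g and y to h.                        *)
Section Eval.
Variables (G : groupType) (g h : G).

Definition leval (l : letter) : G :=
  let z := if l.1 then h else g in if l.2 then z^-1 else z.

Definition F2eval (w : F2) : G := foldr (fun l z => leval l * z) 1 w.

Lemma leval_inv l : leval (linv l) = (leval l)^-1.
Proof. by case: l => b [] /=; rewrite /leval //= invgK. Qed.

Lemma F2evalM : {morph F2eval : u v / u * v}.
Proof.
move=> [u ru] [v rv]; rewrite /F2eval /= {ru}.
have evc l w : foldr (fun l z => leval l * z) 1 (lcons l w) =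
    leval l * foldr (fun l z => leval l * z) 1 w.
  by case: w => //= m w; case: eqP => //= ->; rewrite leval_inv mulKVg.
elim: u => /= [|l u IH]; first by rewrite mul1g.
by rewrite evc IH mulgA.
Qed.

Lemma F2eval1 : F2eval 1 = 1. Proof. by []. Qed.
Lemma F2evalV u : F2eval u^-1 = (F2eval u)^-1.
Proof. by apply: (mulgI (F2eval u)); rewrite -F2evalM !mulgV F2eval1. Qed.
Lemma F2evalx : F2eval F2x = g. Proof. exact: mulg1. Qed.
Lemma F2evaly : F2eval F2y = h. Proof. exact: mulg1. Qed.

Lemma F2eval_unique (f : F2 -> G) : {morph f : u v / u * v} ->
  f F2x = g -> f F2y = h -> f =1 F2eval.
Proof.
move=> fM fx fy.
have f1 : f 1 = 1 by apply: (mulgI (f 1)); rewrite -fM !mulg1.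
have fV u : f u^-1 = (f u)^-1 by apply: (mulgI (f u)); rewrite -fM !mulgV.
have fl l (rl : reduced [:: l]) : f (FreeWord rl) = leval l.
  case: l rl => [[] []] rl; rewrite /leval /= -?fx -?fy -?fV; congr f; exact/val_inj.
case=> w; elim: w => [|l w IH] rw; first by rewrite -[RHS]f1; congr f; apply/val_inj.
have -> : FreeWord rw = FreeWord (isT : reduced [:: l]) * FreeWord (reduced_cons rw).
  by apply/val_inj; rewrite /= -[LHS]lconsE.
by rewrite fM F2evalM fl IH; congr (_ * _); rewrite /F2eval /= mulg1.
Qed.

End Eval.

Lemma F2eval_comp (G : groupType) (g h : G) (u v w : F2) :
  F2eval g h (F2eval u v w) = F2eval (F2eval g h u) (F2eval g h v) w.
Proof.
apply: (@F2eval_unique _ _ _ (F2eval g h \o F2eval u v)) => /=.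
- by move=> a b /=; rewrite !F2evalM.
- by rewrite F2evalx.
- by rewrite F2evaly.
Qed.

Lemma F2eval_id (w : F2) : F2eval F2x F2y w = w.
Proof. by rewrite -(@F2eval_unique _ F2x F2y id). Qed.

(* The quotient groups of fingroup only cover finite groups.                  *)

Record normalSubgroup (F : groupType) := NormalSubgroup {
  ns_mem :> {pred F};
  ns_group : group_closed ns_mem;
  ns_conj : forall u v : F, u \in ns_mem -> u ^ v \in ns_mem }.

Section Quotient.
Variables (F : groupType) (N : normalSubgroup F).

Lemma ns1 : 1 \in N. Proof. by case: (ns_group N). Qed.
Lemma nsV u : u \in N -> u^-1 \in N.
Proof. by case: (ns_group N) => N1 ND uN; rewrite -[u^-1]mul1g ND. Qed.
Lemma nsM u v : u \in N -> v \in N -> u * v \in N.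
Proof.
by case: (ns_group N) => N1 ND uN vN; rewrite -[v]invgK; apply: ND => //; apply: nsV.
Qed.

Definition ns_rel : rel F := fun u v => u^-1 * v \in N.

Lemma ns_equiv : equiv_class_of ns_rel.
Proof.
split; rewrite /ns_rel.
- by move=> u; rewrite mulVg ns1.
- by move=> u v; apply/idP/idP => /nsV; rewrite invgM invgK.
- move=> v u w uv vw.
  have -> : u^-1 * w = (u^-1 * v) * (v^-1 * w) by rewrite !mulgA mulgK.
  exact: nsM.
Qed.
Canonical ns_equiv_rel := EquivRelPack ns_equiv.

Definition quot := {eq_quot ns_equiv_rel}.
HB.instance Definition _ := Choice.on quot.
HB.instance Definition _ := EqQuotient.on quot.

Definition qpi (u : F) : quot := \pi_quot u.

Lemma qpiK (a : quot) : qpi (qrepr a) = a.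
Proof. exact: reprK. Qed.

Lemma quot_eqP u v : reflect (qpi u = qpi v) (u^-1 * v \in N).
Proof. exact: (@eqmodP _ ns_equiv_rel). Qed.

Lemma pi_repr u : (u^-1 * qrepr (qpi u)) \in N.
Proof. by apply/quot_eqP; rewrite qpiK. Qed.

Definition quot_one : quot := qpi 1.
Definition quot_mul (a b : quot) : quot := qpi (qrepr a * qrepr b).
Definition quot_inv (a : quot) : quot := qpi (qrepr a)^-1.

Lemma quot_mulE u v : quot_mul (qpi u) (qpi v) = qpi (u * v).
Proof.
apply/esym/quot_eqP; set u' := qrepr _; set v' := qrepr _.
have -> : (u * v)^-1 * (u' * v') = (u^-1 * u') ^ v * (v^-1 * v').
  by rewrite /conjg invgM !mulgA mulgK.
by apply: nsM; [apply: ns_conj|]; apply: pi_repr.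
Qed.
Lemma quot_invE u : quot_inv (qpi u) = qpi u^-1.
Proof.
apply/quot_eqP; rewrite invgK; set u' := qrepr _.
have -> : u' * u^-1 = (u^-1 * u') ^ u^-1 by rewrite /conjg invgK !mulgA mulgV mul1g.
exact/ns_conj/pi_repr.
Qed.

Lemma quot_mulA : associative quot_mul.
Proof.
move=> a b c; rewrite -(qpiK a) -(qpiK b) -(qpiK c).
by rewrite !quot_mulE mulgA.
Qed.
Lemma quot_mul1 : left_id quot_one quot_mul.
Proof. by move=> a; rewrite -(qpiK a) quot_mulE mul1g. Qed.
Lemma quot_1mul : right_id quot_one quot_mul.
Proof. by move=> a; rewrite -(qpiK a) quot_mulE mulg1. Qed.
Lemma quot_mulV : left_inverse quot_one quot_inv quot_mul.
Proof. by move=> a; rewrite -(qpiK a) quot_invE quot_mulE mulVg. Qed.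
Lemma quot_mulVr : right_inverse quot_one quot_inv quot_mul.
Proof. by move=> a; rewrite -(qpiK a) quot_invE quot_mulE mulgV. Qed.

HB.instance Definition _ := isGroup.Build quot
  quot_mulA quot_mul1 quot_1mul quot_mulV quot_mulVr.

Lemma pi_mul u v : qpi (u * v) = qpi u * qpi v.
Proof. by rewrite -quot_mulE. Qed.
Lemma pi_inv u : qpi u^-1 = (qpi u)^-1.
Proof. by rewrite -quot_invE. Qed.
Lemma pi_one : qpi 1 = 1 :> quot. Proof. by []. Qed.

End Quotient.

Definition quot_iso (F : groupType) (N : normalSubgroup F) (G : groupType) :=
  exists f : quot N -> G, bijective f /\ {morph f : u v / u * v}.

Section Gbar.
Variable G : finGroupType.

Definition generates (gh : G * G) : bool := <<[set gh.1; gh.2]>> == [set: G].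

Record genPair := GenPair { gp : G * G; gpP : generates gp }.
HB.instance Definition _ := [isSub for gp].
HB.instance Definition _ := [Finite of genPair by <:].

Definition pfst (p : genPair) : G := (gp p).1.
Definition psnd (p : genPair) : G := (gp p).2.
Lemma gpE p : gp p = (pfst p, psnd p).
Proof. exact: surjective_pairing. Qed.

Definition peval (p : genPair) : F2 -> G := F2eval (pfst p) (psnd p).

Lemma generatesP (gh : G * G) :
  reflect (forall z, exists w, F2eval gh.1 gh.2 w = z) (generates gh).
Proof.
case: gh => g h /=; apply: (iffP eqP) => /= [gen z | sur].
  have: z \in <<[set g; h]>> by rewrite gen inE.
  pose H := [set z : G | `[< exists w, F2eval g h w = z >]].
  have gH : group_set H.
    apply/group_setP; split=> [|u v].
      by rewrite inE; apply/asboolP; exists 1; rewrite F2eval1.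
    rewrite !inE => /asboolP[a <-] /asboolP[b <-]; apply/asboolP.
    by exists (a * b); rewrite F2evalM.
  have sub : <<[set g; h]>> \subset Group gH.
    rewrite gen_subG; apply/subsetP=> u /set2P[->|->]; rewrite inE; apply/asboolP.
      by exists F2x; rewrite F2evalx.
    by exists F2y; rewrite F2evaly.
  by move/(subsetP sub); rewrite inE => /asboolP.
apply/eqP; rewrite eqEsubset subsetT /=; apply/subsetP=> z _.
case: (sur z) => w <-; rewrite /F2eval; elim: (fword w) => /= [|l u IH].
  exact: group1.
have gg : g \in <<[set g; h]>> by rewrite mem_gen // set21.
have hh : h \in <<[set g; h]>> by rewrite mem_gen // set22.
by apply: groupM => //; case: l => [] [] []; rewrite /leval /= ?groupV.
Qed.

Lemma peval_surj (p : genPair) z : exists w, peval p w = z.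
Proof. by have /generatesP := gpP p; apply. Qed.

Definition NG_mem : {pred F2} :=
  fun w => `[< forall N : normalSubgroup F2, quot_iso N G -> w \in N >].

Lemma NG_memP w :
  reflect (forall N : normalSubgroup F2, quot_iso N G -> w \in N) (w \in NG_mem).
Proof. exact: asboolP. Qed.

Lemma NG_group : group_closed NG_mem.
Proof.
split; first by apply/NG_memP => N _; apply: ns1.
move=> u v /NG_memP uN /NG_memP vN; apply/NG_memP => N iN.
by apply: nsM; [apply: uN | apply/nsV/vN].
Qed.

Lemma NG_conj u v : u \in NG_mem -> u ^ v \in NG_mem.
Proof. by move=> /NG_memP uN; apply/NG_memP => N /uN; apply: ns_conj. Qed.

Definition NG : normalSubgroup F2 := NormalSubgroup NG_group NG_conj.

Section EvalKernel.
Variable p : genPair.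
Definition ker_mem : {pred F2} := fun w => peval p w == 1.
Lemma ker_group : group_closed ker_mem.
Proof.
split; first by apply/eqP.
by move=> u v /eqP eu /eqP ev; apply/eqP; rewrite /peval F2evalM F2evalV; 
   rewrite -/(peval p u) -/(peval p v) eu ev mulgV.
Qed.
Lemma ker_conj u v : u \in ker_mem -> u ^ v \in ker_mem.
Proof.
move=> /eqP eu; apply/eqP; rewrite /peval /conjg !F2evalM F2evalV.
by rewrite -/(peval p u) eu mul1g mulVg.
Qed.
Definition peval_ker : normalSubgroup F2 := NormalSubgroup ker_group ker_conj.

Lemma peval_ker_iso : quot_iso peval_ker G.
Proof.
pose f (a : quot peval_ker) := peval p (qrepr a).
have fpi w : f (qpi _ w) = peval p w.
  have /eqP := pi_repr peval_ker w; rewrite /peval F2evalM F2evalV => e.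
  by apply: (mulgI (peval p w)^-1); rewrite mulVg; apply: e.
have fM : {morph f : u v / u * v}.
  by move=> a b; rewrite -(qpiK a) -(qpiK b) -pi_mul !fpi /peval F2evalM.
exists f; split=> //.
pose g z := qpi peval_ker (projT1 (cid (peval_surj p z))).
have gE z : f (g z) = z by rewrite fpi; case: cid.
exists g => // a; rewrite -(qpiK (g _)) -[RHS]qpiK; apply/quot_eqP.
apply/eqP; rewrite /peval F2evalM F2evalV -/(peval p _) -fpi qpiK gE.
by rewrite /f mulVg.
Qed.
End EvalKernel.

Lemma mem_NG w : reflect (forall p, peval p w = 1) (w \in NG).
Proof.
apply: (iffP (NG_memP w)) => [wN p | ev N [f [bf fM]]].
  by have /eqP := wN _ (peval_ker_iso p).
pose g := f (qpi N F2x); pose h := f (qpi N F2y).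
have fE u : f (qpi N u) = F2eval g h u.
  by apply: (@F2eval_unique _ _ _ (f \o qpi N)) => // a b /=; rewrite pi_mul fM.
have gen : generates (g, h).
  apply/generatesP => z; case: bf => f' _ fK.
  by exists (qrepr (f' z)); rewrite /= -fE qpiK fK.
have := ev (GenPair gen); rewrite /peval -/(F2eval g h w) /pfst /psnd /= -fE => e.
have : f (qpi N w) = f (qpi N 1) by rewrite e fE F2eval1.
move/(bij_inj bf)/esym/quot_eqP.
by rewrite invg1 mul1g.
Qed.

Definition Gbar := quot NG.
HB.instance Definition _ := Group.on Gbar.

Definition gpi (w : F2) : Gbar := qpi NG w.
Definition gx : Gbar := gpi F2x.
Definition gy : Gbar := gpi F2y.

(* The homomorphism Gbar -> G sending gx to pfst p and gy to psnd p.          *)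
Definition Gbar_proj (p : genPair) (u : Gbar) : G := peval p (qrepr u).

Lemma gpiP (u : Gbar) : exists w, u = gpi w.
Proof. by exists (qrepr u); rewrite /gpi qpiK. Qed.

Lemma gpiM u v : gpi (u * v) = gpi u * gpi v.
Proof. exact: pi_mul. Qed.
Lemma gpiV u : gpi u^-1 = (gpi u)^-1.
Proof. exact: pi_inv. Qed.

Lemma Gbar_proj_pi p w : Gbar_proj p (gpi w) = peval p w.
Proof.
have /mem_NG/(_ p) := pi_repr NG w; rewrite /peval F2evalM F2evalV => e.
by apply: (mulgI (peval p w)^-1); rewrite mulVg; apply: e.
Qed.

Lemma Gbar_inj (u v : Gbar) : (forall p, Gbar_proj p u = Gbar_proj p v) -> u = v.
Proof.
case: (gpiP u) (gpiP v) => a -> [b ->] e.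
apply/quot_eqP/mem_NG => p; rewrite /peval F2evalM F2evalV.
by have := e p; rewrite !Gbar_proj_pi /peval => ->; rewrite mulVg.
Qed.

Definition Gbar_code (u : Gbar) : {ffun genPair -> G} := [ffun p => Gbar_proj p u].
Definition Gbar_decode (c : {ffun genPair -> G}) : option Gbar :=
  if pselect (exists u, Gbar_code u = c) is left h then Some (projT1 (cid h)) else None.

Lemma Gbar_codeK : pcancel Gbar_code Gbar_decode.
Proof.
move=> u; rewrite /Gbar_decode; case: pselect => [h|]; last by case; exists u.
congr Some; case: (cid h) => v /= e; apply: Gbar_inj => p.
by have := congr1 (fun c : {ffun genPair -> G} => c p) e; rewrite !ffunE.
Qed.

HB.instance Definition _ := Choice_isCountable.Build Gbar (pcan_pickleK Gbar_codeK).
HB.instance Definition _ : isFinite Gbar := PCanIsFinite Gbar_codeK.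

End Gbar.

Section Outer.
Variable gT : finGroupType.

Definition Inn : {group {perm gT}} := (conj_aut [set: gT] @* [set: gT])%G.
Definition Out : {group coset_of Inn} := (Aut [set: gT] / Inn)%G.

Lemma AutT (a : {perm gT}) :
  (a \in Aut [set: gT]) = [forall u, forall v, a (u * v) == a u * a v].
Proof.
rewrite inE; apply/andP/idP => [[_ /morphicP aM]|aM].
  by apply/'forall_'forall_eqP => u v; rewrite aM ?inE.
split; first by apply/subsetP => u _; rewrite inE.
by apply/morphicP=> u v _ _; move/'forall_'forall_eqP: aM => ->.
Qed.

Lemma AutM (a : {perm gT}) : a \in Aut [set: gT] -> {morph a : u v / u * v}.
Proof. by rewrite AutT => /'forall_'forall_eqP. Qed.

Lemma AutV (a : {perm gT}) : a \in Aut [set: gT] -> {morph a : u / u^-1}.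
Proof.
move=> aA u; apply: (mulgI (a u)); rewrite -(AutM aA) !mulgV.
by apply: (mulgI (a 1)); rewrite -(AutM aA) !mulg1.
Qed.

Lemma conj_autT (z u : gT) : conj_aut [set: gT] z u = u ^ z.
Proof. by rewrite conj_autE ?inE. Qed.

Lemma InnP (a : {perm gT}) : reflect (exists z, forall u, a u = u ^ z) (a \in Inn).
Proof.
apply: (iffP morphimP) => [[z _ _ ->]|[z az]]; first by exists z; apply: conj_autT.
exists z; rewrite ?(subsetP (normG _)) ?inE //.
by apply/(@permP gT) => u; rewrite /= conj_autT.
Qed.

Lemma Inn_normal : Inn <| Aut [set: gT].
Proof.
apply/andP; split; first exact: Aut_conj_aut.
apply/subsetP => a aA; rewrite inE; apply/subsetP => b.
move=> /imsetP[c /InnP[z cz] ->]; apply/InnP; exists (a z) => u.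
rewrite /conjg !permM cz /conjg !(AutM aA) (AutV aA).
by rewrite -[a (a^-1 u)]permM mulVg perm1.
Qed.

End Outer.

Section Pairs.
Variable G : finGroupType.

Definition autPair (a : {perm G}) (p : genPair G) : genPair G :=
  insubd p (a (pfst p), a (psnd p)).

(* The image pair generates G when a is an automorphism, so that insubd does  *)
(* not use its default value.                                                 *)
Lemma autPairE (a : {perm G}) (p : genPair G) : a \in Aut [set: G] ->
  gp (autPair a p) = (a (pfst p), a (psnd p)).
Proof.
move=> aA; rewrite -[LHS]/(val _) insubdK //; apply/generatesP => z.
have [w ew] := peval_surj p (a^-1 z); exists w => /=.
rewrite -(@F2eval_unique _ _ _ (fun v => a (peval p v))).
- by rewrite ew permKV.
- by move=> u v /=; rewrite /peval F2evalM (AutM aA).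
- by rewrite /peval F2evalx.
- by rewrite /peval F2evaly.
Qed.

Definition conjPair : rel (genPair G) := fun p q =>
  [exists z, (pfst p ^ z == pfst q) && (psnd p ^ z == psnd q)].

Lemma conjPairP p q :
  reflect (exists z, pfst p ^ z = pfst q /\ psnd p ^ z = psnd q) (conjPair p q).
Proof.
apply: (iffP existsP) => [[z /andP[/eqP e /eqP f]]|[z [e f]]]; exists z => //.
by rewrite e f !eqxx.
Qed.

Lemma conjPair_equiv : equiv_class_of conjPair.
Proof.
have sym p q : conjPair p q -> conjPair q p.
  by case/conjPairP=> z [e f]; apply/conjPairP; exists z^-1; rewrite -e -f !conjgK.
split.
- by move=> p; apply/conjPairP; exists 1; rewrite !conjg1.
- by move=> p q; apply/idP/idP; apply: sym.
- move=> p q r /conjPairP[z [e f]] /conjPairP[t [e' f']].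
  by apply/conjPairP; exists (z * t); rewrite !conjgM e f.
Qed.
Canonical conjPair_equiv_rel := EquivRelPack conjPair_equiv.

Definition Pc := {eq_quot conjPair_equiv_rel}.
HB.instance Definition _ := Choice.on Pc.
HB.instance Definition _ := EqQuotient.on Pc.

Definition pcl (p : genPair G) : Pc := \pi_Pc p.

Lemma pclK : cancel (fun c : Pc => qrepr c) pcl.
Proof. exact: reprK. Qed.

HB.instance Definition _ := Choice_isCountable.Build Pc (pcan_pickleK (can_pcan pclK)).
HB.instance Definition _ : isFinite Pc := CanIsFinite pclK.

Lemma pclP p q : reflect (pcl p = pcl q) (conjPair p q).
Proof. exact: (@eqmodP _ conjPair_equiv_rel). Qed.

Lemma pcl_repr p : conjPair (qrepr (pcl p)) p.
Proof. by apply/pclP; rewrite pclK. Qed.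

Definition out_act (A : coset_of (Inn G)) (c : Pc) : Pc :=
  pcl (autPair (repr A) (qrepr c)).

Lemma autPair_pcl (a b : {perm G}) (p q : genPair G) :
  a \in Aut [set: G] -> b \in a *: Inn G -> conjPair p q ->
  pcl (autPair a p) = pcl (autPair b q).
Proof.
move=> aA /lcosetP[i iI ->] /conjPairP[z [e f]].
have iA : i \in Aut [set: G] by apply: (subsetP (normal_sub (Inn_normal G))).
case/InnP: (iI) => t it; apply/pclP/conjPairP; exists (a z * t).
rewrite /pfst /psnd !autPairE ?groupM //= !permM !it !conjgM -e -f /conjg.
by rewrite !(AutM aA) !(AutV aA).
Qed.

Lemma out_actE (a : {perm G}) (p : genPair G) : a \in Aut [set: G] ->
  out_act (coset (Inn G) a) (pcl p) = pcl (autPair a p).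
Proof.
move=> aA; have aN : a \in 'N(Inn G) by apply: (subsetP (normal_norm (Inn_normal G))).
apply/esym/autPair_pcl => //; last by apply/pclP; rewrite pclK.
by rewrite -(norm_rlcoset aN) -val_coset // mem_repr_coset.
Qed.

(* Independent of the representatives, see Pc_relE.                           *)
Definition Pc_rel (c d : Pc) : bool :=
  (pfst (qrepr c) \in pfst (qrepr d) ^: [set: G]) &&
  (psnd (qrepr c) \in psnd (qrepr d) ^: [set: G]).

Lemma Pc_relE p q : Pc_rel (pcl p) (pcl q) =
  (pfst p \in pfst q ^: [set: G]) && (psnd p \in psnd q ^: [set: G]).
Proof.
rewrite /Pc_rel.
have /conjPairP[z [e1 e2]] := pcl_repr p; have /conjPairP[t [f1 f2]] := pcl_repr q.
have J (u v a b : G) : (u ^ a \in (v ^ b) ^: [set: G]) = (u \in v ^: [set: G]).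
  by rewrite classGidl ?inE // class_sym classGidl ?inE // class_sym.
by rewrite -e1 -e2 -f1 -f2 !J.
Qed.

End Pairs.

Section ThetaDelta.
Variable G : finGroupType.

(* The endomorphism of Gbar induced by x |-> u, y |-> v, when u and v         *)
(* generate F2.                                                               *)
Definition Gbar_endo (u v : F2) (a : Gbar G) : Gbar G :=
  gpi G (F2eval u v (qrepr a)).

Lemma Gbar_endo_pi u v : (exists a, F2eval u v a = F2x) ->
    (exists b, F2eval u v b = F2y) ->
  forall w, Gbar_endo u v (gpi G w) = gpi G (F2eval u v w).
Proof.
move=> [a ea] [b eb] w; apply: Gbar_inj => p; rewrite !Gbar_proj_pi /peval !F2eval_comp.
set q := (F2eval (pfst p) (psnd p) u, F2eval (pfst p) (psnd p) v).
have gen : generates q.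
  apply/generatesP => z; have [c <-] := peval_surj p z.
  by exists (F2eval a b c); rewrite -F2eval_comp (F2eval_comp u v) ea eb F2eval_id.
exact: (Gbar_proj_pi (GenPair gen)).
Qed.

Definition theta_fun := Gbar_endo F2y F2x.
Definition delta_fun := Gbar_endo (F2y^-1 * F2x^-1) F2y.

Lemma theta_pi w : theta_fun (gpi G w) = gpi G (F2eval F2y F2x w).
Proof.
apply: Gbar_endo_pi; first by exists F2y; rewrite F2evaly.
by exists F2x; rewrite F2evalx.
Qed.

Lemma delta_pi w : delta_fun (gpi G w) = gpi G (F2eval (F2y^-1 * F2x^-1) F2y w).
Proof.
apply: Gbar_endo_pi; last by exists F2y; rewrite F2evaly.
exists (F2x^-1 * F2y^-1); rewrite F2evalM !F2evalV F2evalx F2evaly.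
by rewrite invgM !invgK mulgK.
Qed.

Lemma theta_inj : injective theta_fun.
Proof.
apply: (can_inj (g := theta_fun)) => a; have [w ->] := gpiP a.
by rewrite !theta_pi F2eval_comp F2evalx F2evaly F2eval_id.
Qed.

Lemma delta_inj : injective delta_fun.
Proof.
apply: (can_inj (g := Gbar_endo (F2x^-1 * F2y^-1) F2y)) => a; have [w ->] := gpiP a.
rewrite delta_pi Gbar_endo_pi; first last.
- by exists F2y; rewrite F2evaly.
- exists (F2y^-1 * F2x^-1); rewrite F2evalM !F2evalV F2evalx F2evaly.
  by rewrite invgM !invgK mulKg.
rewrite F2eval_comp F2evalM !F2evalV F2evalx F2evaly invgM !invgK mulKg.
by rewrite F2eval_id.
Qed.

Definition theta : {perm Gbar G} := perm theta_inj.
Definition delta : {perm Gbar G} := perm delta_inj.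

Lemma thetaP :
  [/\ theta \in Aut [set: Gbar G], theta (gx G) = gy G & theta (gy G) = gx G].
Proof.
split; last 2 first.
- by rewrite permE theta_pi F2evalx.
- by rewrite permE theta_pi F2evaly.
rewrite AutT; apply/'forall_'forall_eqP => u v.
have [a ->] := gpiP u; have [b ->] := gpiP v.
by rewrite -gpiM !permE !theta_pi F2evalM gpiM.
Qed.

Lemma deltaP : [/\ delta \in Aut [set: Gbar G],
  delta (gx G) = (gy G)^-1 * (gx G)^-1 & delta (gy G) = gy G].
Proof.
split; last 2 first.
- by rewrite permE delta_pi F2evalx gpiM !gpiV.
- by rewrite permE delta_pi F2evaly.
rewrite AutT; apply/'forall_'forall_eqP => u v.
have [a ->] := gpiP u; have [b ->] := gpiP v.
by rewrite -gpiM !permE !delta_pi F2evalM gpiM.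
Qed.

Definition GT1_aut : {set {perm Gbar G}} :=
  [set phi in Aut [set: Gbar G] |
    [&& phi (gx G) \in gx G ^: [set: Gbar G],
        coset (Inn (Gbar G)) phi \in 'C[coset (Inn (Gbar G)) theta] &
        coset (Inn (Gbar G)) phi \in 'C[coset (Inn (Gbar G)) delta]]].

Lemma GT1_aut_group : group_set GT1_aut.
Proof.
apply/group_setP; split=> [|a b].
  by rewrite in_set group1 perm1 class_refl morph1 !group1.
rewrite in_set => /and4P[aA ax aT aD]; rewrite in_set => /and4P[bA bx bT bD].
rewrite in_set.
have aN := subsetP (normal_norm (Inn_normal _)) _ aA.
have bN := subsetP (normal_norm (Inn_normal _)) _ bA.
rewrite groupM // morphM //= !groupM // !andbT permM.
case/imsetP: ax => z _ ->.
have -> : b (gx G ^ z) = b (gx G) ^ b z by rewrite /conjg !(AutM bA) (AutV bA).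
by rewrite class_sym classGidl ?inE // class_sym.
Qed.
Canonical GT1_aut_gr := Group GT1_aut_group.

Definition GT1 : {group coset_of (Inn (Gbar G))} := (GT1_aut / Inn (Gbar G))%G.

Lemma Gbar_proj_morph (p : genPair G) : {in [set: Gbar G] &, {morph Gbar_proj p : u v / u * v}}.
Proof.
move=> u v _ _; have [a ->] := gpiP u; have [b ->] := gpiP v.
by rewrite -gpiM !Gbar_proj_pi /peval F2evalM.
Qed.
Canonical Gbar_proj_morphism p := Morphism (@Gbar_proj_morph p).

Lemma projx p : Gbar_proj p (gx G) = pfst p.
Proof. by rewrite Gbar_proj_pi /peval F2evalx. Qed.
Lemma projy p : Gbar_proj p (gy G) = psnd p.
Proof. by rewrite Gbar_proj_pi /peval F2evaly. Qed.

End ThetaDelta.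

(* Representatives of the orbits of Aut G on the generating pairs.            *)
Record orbitReps (G : finGroupType) := OrbitReps {
  nreps : nat;
  rep :> 'I_nreps -> genPair G;
  repP : forall p : genPair G,
    exists! i, exists2 a, a \in Aut [set: G] & p = autPair a (rep i) }.

Lemma autPairM (G : finGroupType) (a b : {perm G}) (p : genPair G) :
  a \in Aut [set: G] -> b \in Aut [set: G] ->
  autPair b (autPair a p) = autPair (a * b) p.
Proof.
move=> aA bA; apply/val_inj; rewrite /= !autPairE ?groupM //.
by rewrite /pfst /psnd autPairE //= !permM.
Qed.

Lemma autPair1 (G : finGroupType) (p : genPair G) : autPair 1 p = p.
Proof.
apply/val_inj; rewrite /= autPairE ?group1 // !perm1.
by rewrite /pfst /psnd; case: (gp p).
Qed.

Lemma orbitReps_exist (G : finGroupType) : inhabited (orbitReps G).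
Proof.
pose e (p q : genPair G) := [exists (a | a \in Aut [set: G]), q == autPair a p].
have eP p q : reflect (exists2 a, a \in Aut [set: G] & q = autPair a p) (e p q).
  by apply: (iffP exists_inP) => [[a aA /eqP ->]|[a aA ->]]; exists a.
have e1 p : e p p by apply/eP; exists 1; rewrite ?group1 ?autPair1.
have eS p q : e p q -> e q p.
  case/eP=> a aA ->; apply/eP; exists a^-1; rewrite ?groupV //.
  by rewrite autPairM ?groupV // mulgV autPair1.
have eT p q r : e p q -> e q r -> e p r.
  case/eP=> a aA ->; case/eP=> b bA ->; apply/eP; exists (a * b); first exact: groupM.
  by rewrite autPairM.
pose f p := odflt p [pick q | e p q].
have ef p : e p (f p) by rewrite /f; case: pickP => //= /(_ p); rewrite e1.
have fE p q : e p q -> f p = f q.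
  move=> epq; rewrite /f (@eq_pick _ (e p) (e q)) => [|r].
    by case: pickP => //= /(_ q); rewrite e1.
  by apply/idP/idP; apply: eT => //; apply: eS.
pose S := [set f p | p : genPair G].
split; apply: (@OrbitReps G #|S| (fun i => enum_val i)) => p.
have fS : f p \in S by apply: imset_f.
exists (enum_rank_in fS (f p)); split.
  by rewrite enum_rankK_in //; apply/eP/eS.
move=> i /eP eip; apply: enum_val_inj; rewrite enum_rankK_in //.
have /imsetP[q _ eq] := enum_valP i.
by rewrite -(fE _ _ eip) eq -(fE _ _ (ef q)).
Qed.

Section Action.
Variables (G : finGroupType) (R : orbitReps G).
Implicit Types (phi : {perm Gbar G}) (i : 'I_(nreps R)) (c : Pc G).

Definition repker i : {group Gbar G} := 'ker (Gbar_proj (R i))%G.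

Definition sigma phi i : 'I_(nreps R) :=
  odflt i [pick j | phi @: repker i == repker j :> {set Gbar G}].

(* The automorphism phi_i of G with phi_i \o p_i = p_(sigma i) \o phi.        *)
Definition autrep phi i : {perm G} :=
  odflt 1 [pick a in Aut [set: G] |
    [forall u, a (Gbar_proj (R i) u) == Gbar_proj (R (sigma phi i)) (phi u)]].

(* Permutations multiply from left to right: (autrep phi i)^-1 * a is the     *)
(* composite of the inverse of autrep phi i followed by a.                    *)
Definition Pc_act phi c : Pc G :=
  if [pick ia : 'I_(nreps R) * {perm G} |
        (ia.2 \in Aut [set: G]) && (c == pcl (autPair ia.2 (R ia.1)))]
  is Some (i, a) then pcl (autPair ((autrep phi i)^-1 * a) (R (sigma phi i)))
  else c.

Definition SG : {set {perm Pc G}} :=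
  [set s : {perm Pc G} |
          [&& [forall A in Out G, forall c, s (out_act A c) == out_act A (s c)],
               [forall c, s (Pc_act (theta G) c) == Pc_act (theta G) (s c)],
               [forall c, s (Pc_act (delta G) c) == Pc_act (delta G) (s c)] &
               [forall c, Pc_rel (s c) c]]].

Lemma SG_group : group_set SG.
Proof.
apply/group_setP; split=> [|s t]; rewrite inE.
  apply/and4P; split.
  - by apply/forall_inP => A _; apply/forallP => c; rewrite !perm1.
  - by apply/forallP => c; rewrite !perm1.
  - by apply/forallP => c; rewrite !perm1.
  - by apply/forallP => c; rewrite perm1 /Pc_rel !class_refl.
move=> /and4P[/forall_inP s1 /forallP s2 /forallP s3 /forallP s4].
rewrite inE => /and4P[/forall_inP t1 /forallP t2 /forallP t3 /forallP t4].
rewrite inE; apply/and4P; split.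
- apply/forall_inP => A AO; apply/forallP => c; rewrite !permM.
  by rewrite (eqP (forallP (s1 A AO) c)) (eqP (forallP (t1 A AO) _)).
- by apply/forallP => c; rewrite !permM (eqP (s2 c)) (eqP (t2 _)).
- by apply/forallP => c; rewrite !permM (eqP (s3 c)) (eqP (t3 _)).
- apply/forallP => c; rewrite !permM; have := s4 c; have := t4 (s c).
  move=> /andP[u1 u2] /andP[v1 v2]; apply/andP; split.
    exact: class_trans v1.
  exact: class_trans v2.
Qed.
Canonical SG_gr := Group SG_group.

Lemma Gbar_proj_surj (p : genPair G) z : exists u, Gbar_proj p u = z.
Proof. by have [w <-] := peval_surj p z; exists (gpi G w); rewrite Gbar_proj_pi. Qed.

Lemma Gbar_hom_eq (f : Gbar G -> G) (p : genPair G) : {morph f : u v / u * v} ->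
  f (gx G) = pfst p -> f (gy G) = psnd p -> f =1 Gbar_proj p.
Proof.
move=> fM fx fy u; have [w ->] := gpiP u; rewrite Gbar_proj_pi.
by apply: (@F2eval_unique _ _ _ (f \o gpi G)) => // a b /=; rewrite gpiM fM.
Qed.

Lemma Gbar_proj_autPair (a : {perm G}) p u : a \in Aut [set: G] ->
  a (Gbar_proj p u) = Gbar_proj (autPair a p) u.
Proof.
move=> aA; apply: (@Gbar_hom_eq (fun u => a (Gbar_proj p u))).
- by move=> v w; rewrite Gbar_proj_morph ?inE // (AutM aA).
- by rewrite projx [RHS]/pfst autPairE.
- by rewrite projy [RHS]/psnd autPairE.
Qed.

(* The generating pair given by Gbar_proj p \o phi^-1.                        *)
Lemma twist_gen phi (p : genPair G) : phi \in Aut [set: Gbar G] ->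
  generates (Gbar_proj p (phi^-1 (gx G)), Gbar_proj p (phi^-1 (gy G))).
Proof.
move=> phiA; apply/generatesP => z; have [u <-] := Gbar_proj_surj p z.
have [w ew] := gpiP (phi u); exists w => /=.
rewrite -(@F2eval_unique _ _ _ (fun v => Gbar_proj p (phi^-1 (gpi G v)))) //.
  by rewrite -ew permK.
move=> a b /=; rewrite gpiM (AutM (groupVr phiA)).
by rewrite Gbar_proj_morph ?inE.
Qed.

Definition twist phi (phiA : phi \in Aut [set: Gbar G]) (p : genPair G) : genPair G :=
  GenPair (twist_gen p phiA).

Lemma gp_twist phi (phiA : phi \in Aut [set: Gbar G]) p :
  gp (twist phiA p) = (Gbar_proj p (phi^-1 (gx G)), Gbar_proj p (phi^-1 (gy G))).
Proof. by []. Qed.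

Lemma Gbar_proj_twist phi (phiA : phi \in Aut [set: Gbar G]) p u :
  Gbar_proj (twist phiA p) u = Gbar_proj p (phi^-1 u).
Proof.
apply/esym/(@Gbar_hom_eq (fun u => Gbar_proj p (phi^-1 u))) => // a b /=.
by rewrite (AutM (groupVr phiA)) Gbar_proj_morph ?inE.
Qed.

Lemma twist_autPair phi (phiA : phi \in Aut [set: Gbar G]) a p :
  a \in Aut [set: G] -> twist phiA (autPair a p) = autPair a (twist phiA p).
Proof.
by move=> aA; apply/val_inj; rewrite /= autPairE // /pfst /psnd /= !Gbar_proj_autPair.
Qed.

Lemma mem_repker i u : (u \in repker i) = (Gbar_proj (R i) u == 1).
Proof. by rewrite !inE. Qed.

Lemma twist_sigma phi (phiA : phi \in Aut [set: Gbar G]) i :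
  phi @: repker i = repker (sigma phi i) /\
  exists2 a, a \in Aut [set: G] & twist phiA (R i) = autPair a (R (sigma phi i)).
Proof.
have KE j a : a \in Aut [set: G] -> twist phiA (R i) = autPair a (R j) -> phi @: repker i = repker j.
  move=> aA tE; apply/setP => u; rewrite mem_repker.
  rewrite -(inj_eq (@perm_inj _ a)) Gbar_proj_autPair // -tE Gbar_proj_twist.
  have -> : a 1 = 1 by apply: (mulgI (a 1)); rewrite -(AutM aA) !mulg1.
  rewrite -mem_repker; apply/imsetP/idP => [[v vK ->]|uK]; first by rewrite permK.
  by exists (phi^-1 u); rewrite ?permKV.
have sK : phi @: repker i = repker (sigma phi i).
  rewrite /sigma; case: pickP => [j /eqP //|no].
  have [j [[a aA tE] _]] := repP R (twist phiA (R i)).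
  by have := no j; rewrite (KE j a) // eqxx.
split=> //.
set q := twist phiA (R i); set p := R (sigma phi i).
have kE u v : (Gbar_proj p u == Gbar_proj p v) = (Gbar_proj q u == Gbar_proj q v).
  have h r : (Gbar_proj r u == Gbar_proj r v) = (u^-1 * v \in 'ker (Gbar_proj r)).
    rewrite !inE /= Gbar_proj_morph ?inE // (morphV (Gbar_proj_morphism r)) ?inE //=.
    by rewrite -eq_mulVg1.
  rewrite !{}h //; rewrite -[in LHS]/(gval (repker (sigma phi i))) -sK.
  apply/imsetP/idP => [[w wK ->]|].
    by move: wK; rewrite mem_repker !inE /= Gbar_proj_twist permK.
  rewrite !inE /= Gbar_proj_twist => /eqP e; exists (phi^-1 (u^-1 * v)); last by rewrite permKV.
  by rewrite mem_repker e.
pose f z := Gbar_proj q (projT1 (cid (Gbar_proj_surj p z))).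
have fE u : f (Gbar_proj p u) = Gbar_proj q u.
  by rewrite /f; case: cid => v /= /eqP; rewrite kE => /eqP.
have f_inj : injective f.
  move=> y z; have [u <-] := Gbar_proj_surj p y; have [v <-] := Gbar_proj_surj p z.
  by rewrite !fE => /eqP; rewrite -kE => /eqP.
have aA : perm f_inj \in Aut [set: G].
  rewrite AutT; apply/'forall_'forall_eqP => y z.
  have [u <-] := Gbar_proj_surj p y; have [v <-] := Gbar_proj_surj p z.
  by rewrite -Gbar_proj_morph ?inE // !permE !fE Gbar_proj_morph ?inE.
exists (perm f_inj) => //; apply: val_inj; rewrite -[LHS]/(gp q) -[RHS]/(gp _).
by rewrite autPairE // !permE -(projx p) -(projy p) !fE projx projy gpE.
Qed.

Lemma autrepP phi (phiA : phi \in Aut [set: Gbar G]) i :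
  autrep phi i \in Aut [set: G] /\
  forall u, autrep phi i (Gbar_proj (R i) u) = Gbar_proj (R (sigma phi i)) (phi u).
Proof.
rewrite /autrep; case: pickP => [a /andP[aA /'forall_eqP ae] //|no].
have [_ [a aA tE]] := twist_sigma phiA i.
case/negP: (negbT (no a^-1)); rewrite groupVr //=; apply/'forall_eqP => u.
by rewrite -[u in LHS](permK phi) -Gbar_proj_twist tE -Gbar_proj_autPair // permK.
Qed.

Lemma sigmaP phi : phi \in Aut [set: Gbar G] -> forall i, phi @: repker i = repker (sigma phi i).
Proof. by move=> phiA i; have [] := twist_sigma phiA i. Qed.

Lemma twist_rep phi (phiA : phi \in Aut [set: Gbar G]) (a : {perm G}) i :
  a \in Aut [set: G] ->
  autPair ((autrep phi i)^-1 * a) (R (sigma phi i)) = twist phiA (autPair a (R i)).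
Proof.
move=> aA; have [bA bE] := autrepP phiA i.
rewrite -autPairM ?groupV // twist_autPair //; congr autPair.
apply/val_inj; rewrite /= autPairE ?groupV // -projx -projy.
by rewrite -{1}[gx G](permKV phi) -{1}[gy G](permKV phi) -!bE !permK.
Qed.

Lemma Pc_act_twist phi (phiA : phi \in Aut [set: Gbar G]) p :
  Pc_act phi (pcl p) = pcl (twist phiA p).
Proof.
rewrite /Pc_act; case: pickP => [[i a] /= /andP[aA /eqP e]|no].
  rewrite (twist_rep phiA) //; move/pclP/conjPairP: e => [z [e1 e2]].
  have pE u : Gbar_proj p u ^ z = Gbar_proj (autPair a (R i)) u.
    apply: (@Gbar_hom_eq (fun u => Gbar_proj p u ^ z)).
    - by move=> v w; rewrite Gbar_proj_morph ?inE // conjMg.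
    - by rewrite projx.
    - by rewrite projy.
  by apply/esym/pclP/conjPairP; exists z; rewrite /pfst /psnd /= !pE.
have [i [[a aA pE] _]] := repP R p.
by have := no (i, a); rewrite /= aA pE eqxx.
Qed.

Lemma Pc_actE phi (a : {perm G}) i :
  phi \in Aut [set: Gbar G] -> a \in Aut [set: G] ->
  Pc_act phi (pcl (autPair a (R i))) =
    pcl (autPair ((autrep phi i)^-1 * a) (R (sigma phi i))).
Proof. by move=> phiA aA; rewrite (Pc_act_twist phiA) twist_rep. Qed.

Lemma Pc_act_theta p q : pfst q = psnd p -> psnd q = pfst p ->
  Pc_act (theta G) (pcl p) = pcl q.
Proof.
move=> e1 e2; have [tA tx ty] := thetaP G; rewrite (Pc_act_twist tA); congr pcl.
have tVx : (theta G)^-1 (gx G) = gy G by rewrite -{1}ty permK.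
have tVy : (theta G)^-1 (gy G) = gx G by rewrite -{1}tx permK.
apply: val_inj; rewrite -[LHS]/(gp _) -[RHS]/(gp _).
by rewrite gp_twist tVx tVy projx projy gpE e1 e2.
Qed.

Lemma Pc_act_delta p q : pfst q = (psnd p)^-1 * (pfst p)^-1 -> psnd q = psnd p ->
  Pc_act (delta G) (pcl p) = pcl q.
Proof.
move=> e1 e2; have [dA dx dy] := deltaP G; rewrite (Pc_act_twist dA).
have dV := groupVr dA.
have dyV : (delta G)^-1 (gy G) = gy G by rewrite -{1}dy permK.
have dxV : (delta G)^-1 (gx G) = (gx G)^-1 * (gy G)^-1.
  have := congr1 (delta G)^-1 dx; rewrite permK (AutM dV) !(AutV dV) dyV => e.
  by rewrite {2}e invgM !invgK mulgK.
apply/pclP/conjPairP; exists (psnd p).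
rewrite -[pfst (twist _ _)]/(gp _).1 -[psnd (twist _ _)]/(gp _).2 gp_twist.
rewrite -[(_, _).1]/(Gbar_proj _ _) -[(_, _).2]/(Gbar_proj _ _) dxV dyV projy e1 e2.
rewrite Gbar_proj_morph ?inE // !(morphV (Gbar_proj_morphism p)) ?inE //= projx projy.
by rewrite /conjg !mulgA mulgKV mulVg mul1g.
Qed.

Lemma Pc_act_inj phi : phi \in Aut [set: Gbar G] -> injective (Pc_act phi).
Proof.
move=> phiA; apply: (can_inj (g := Pc_act phi^-1)) => c.
rewrite -[c]pclK (Pc_act_twist phiA) (Pc_act_twist (groupVr phiA)); congr pcl.
apply: val_inj; rewrite -[LHS]/(gp _) -[RHS]/(gp _).
by rewrite gp_twist !Gbar_proj_twist !permKV projx projy gpE.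
Qed.

End Action.

(* Main.v *)
Require Import Defs.
From mathcomp Require Import all_boot all_fingroup gseries commutator.
From mathcomp Require boolp.

(* Distinct kernels K_i have non-abelian simple quotients, so p_i maps the
   intersection of the other kernels onto G and the p_i together identify Gbar
   with G^r.  An automorphism acting trivially on Pc satisfies
   p_i (phi^-1 v) = p_i v ^ z_i, hence is inner: conjugate by an element with
   components z_i.  Conversely, if s commutes with Out G and s [x_i, y_i] is the
   class of the pair q_i, the automorphism psi given by p_i (psi u) = q_i u
   induces s by its inverse; it commutes with theta and delta in Out Gbar because
   the action is faithful, and psi x is conjugate to x because this holds in every
   component. *)

Local Open Scope group_scope.

(** * Surjections from [Gbar] onto [G] and classes of generating pairs *)

Lemma pcl_eqP (G : finGroupType) (p q : genPair G) :
  pcl p = pcl q <-> exists z, forall u, Gbar_proj q u = Gbar_proj p u ^ z.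
Proof.
split=> [/pclP/conjPairP[z [ex ey]] | [z qE]].
  exists z => u; apply/esym.
  apply: (@Gbar_hom_eq _ (fun u => Gbar_proj p u ^ z)); rewrite ?projx ?projy //.
  by move=> v w; rewrite Gbar_proj_morph ?inE // conjMg.
by apply/pclP/conjPairP; exists z; rewrite -!projx -!projy !qE.
Qed.

Lemma Gbar_proj_conj (G : finGroupType) (p : genPair G) (u v : Gbar G) :
  Gbar_proj p (u ^ v) = Gbar_proj p u ^ Gbar_proj p v.
Proof. by rewrite (morphJ (Gbar_proj_morphism p)) ?inE. Qed.

(** Up to conjugation, every projection is an automorphism of [G] composed with some
    [Gbar_proj (Q i)]. The family is arbitrary so as to cover both the orbit representatives and
    their images under a permutation of [Pc]. *)
Lemma Gbar_proj_separate (G : finGroupType) (I : Type) (Q : I -> genPair G) :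
    (forall p, exists i, exists2 a, a \in Aut [set: G] &
       pcl p = pcl (autPair a (Q i))) ->
  forall u v, (forall i, Gbar_proj (Q i) u = Gbar_proj (Q i) v) -> u = v.
Proof.
move=> Qall u v eQ; apply: Gbar_inj => p.
have [i [a aA /esym/pcl_eqP[z pE]]] := Qall p.
by rewrite !pE -!Gbar_proj_autPair // eQ.
Qed.

(** * The permutation action of automorphisms of [Gbar] *)

Section Action.
Context {G : finGroupType} (R : orbitReps G).

Lemma repP_pcl p : exists i, exists2 a, a \in Aut [set: G] &
  pcl p = pcl (autPair a (R i)).
Proof. by have [i [[a aA ->] _]] := repP R p; exists i, a. Qed.

Lemma rep_separate u v :
  (forall i, Gbar_proj (R i) u = Gbar_proj (R i) v) -> u = v.
Proof. exact: Gbar_proj_separate repP_pcl u v. Qed.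

(** Uniqueness of orbit representatives gives [sigma 1 i = i], while [sigma 1 i] is picked from the
    kernel alone. *)
Lemma repker_inj : injective (@repker G R).
Proof.
have A1 : (1 : {perm Gbar G}) \in Aut [set: Gbar G] by apply: group1.
have s1 (i : 'I_(nreps R)) : sigma 1 i = i.
  have [_ [a aA tE]] := twist_sigma A1 i.
  have t1 : twist A1 (R i) = R i.
    by apply: val_inj; rewrite /= invg1 !perm1 projx projy -gpE.
  have [j [_ uj]] := repP R (R i).
  transitivity j; last by apply: uj; exists 1; rewrite ?group1 ?autPair1.
  by apply/esym/uj; exists a => //; rewrite -tE t1.
(* The differing defaults [i] and [k] of [odflt] never occur, since [k] satisfies the picked
   predicate. *)
move=> i k eK; rewrite -[i]s1 -[k]s1 /sigma eK; case: pickP => // /(_ k).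
by rewrite (eq_imset _ (@perm1 _)) imset_id eqxx.
Qed.

(** Matching on [idP] supplies the proof that [Pc_act_inj] requires; the default 1 is taken only
    outside the domain of the morphism. *)
Definition Pc_perm (phi : {perm Gbar G}) : {perm Pc G} :=
  if @idP (phi \in Aut [set: Gbar G]) is ReflectT phiA
  then perm (@Pc_act_inj G R phi phiA) else 1.

Lemma Pc_permE phi c : phi \in Aut [set: Gbar G] -> Pc_perm phi c = Pc_act R phi c.
Proof. by rewrite /Pc_perm; case: {-}_ / idP => // *; rewrite permE. Qed.

Lemma Pc_perm_pcl phi (phiA : phi \in Aut [set: Gbar G]) p :
  Pc_perm phi (pcl p) = pcl (twist phiA p).
Proof. by rewrite Pc_permE // Pc_act_twist. Qed.

Lemma Pc_permM : {in Aut [set: Gbar G] &, {morph Pc_perm : phi psi / phi * psi}}.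
Proof.
move=> phi psi phiA psiA; apply/permP => c; rewrite -[c]pclK permM.
rewrite !(Pc_perm_pcl _ phiA) (Pc_perm_pcl _ psiA) (Pc_perm_pcl _ (groupM phiA psiA)).
congr pcl; apply: val_inj.
by rewrite /= !Gbar_proj_twist !invMg !permM.
Qed.
Canonical Pc_perm_morphism := Morphism Pc_permM.

Lemma Pc_perm_Out phi a c :
    phi \in Aut [set: Gbar G] -> a \in Aut [set: G] ->
  Pc_perm phi (out_act (coset (Inn G) a) c) = out_act (coset (Inn G) a) (Pc_perm phi c).
Proof.
move=> phiA aA; rewrite -[c]pclK out_actE // !(Pc_perm_pcl _ phiA) out_actE //.
by rewrite twist_autPair.
Qed.

Lemma Inn_ker_Pc_perm : Inn (Gbar G) \subset 'ker Pc_perm.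
Proof.
apply/subsetP => phi phiI.
have phiA := subsetP (normal_sub (Inn_normal (Gbar G))) _ phiI.
have /InnP[z zE] := groupVr phiI.
apply/(kerP _ phiA)/permP => c.
rewrite -[c]pclK (Pc_perm_pcl _ phiA) perm1; apply/esym/pcl_eqP.
by exists (Gbar_proj (qrepr c) z) => u; rewrite Gbar_proj_twist zE Gbar_proj_conj.
Qed.

End Action.

(** * [Gbar] as a direct power of a non-abelian simple group *)

Section Simple.
Context {G : finGroupType} (R : orbitReps G).
Hypotheses (simpleG : simple [set: G]) (nabG : ~~ abelian [set: G]).

Lemma normal_simpleT (H : {group G}) :
  H <| [set: G] -> (H :=: 1) \/ (H :=: [set: G]).
Proof. by case/simpleP: simpleG => _ sG /sG. Qed.

Lemma morphim_projT p : Gbar_proj_morphism p @* [set: Gbar G] = [set: G].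
Proof.
apply/setP => z; rewrite inE; have [u <-] := Gbar_proj_surj p z.
by rewrite mem_morphim ?inE.
Qed.

(** A trivial image would put [repker k] inside [repker i]; both have index [#|G|], so they would
    coincide, against [repker_inj]. *)
Lemma morphim_repker (i k : 'I_(nreps R)) : k != i ->
  Gbar_proj_morphism (R i) @* repker k = [set: G].
Proof.
move=> neki.
have nK : Gbar_proj_morphism (R i) @* repker k <| [set: G].
  by rewrite -(morphim_projT (R i)) morphim_normal ?ker_normal.
case: (normal_simpleT _ nK) => // K1; case/eqP: neki; apply: (repker_inj R).
apply/val_inj/eqP; rewrite /= eqEcard; apply/andP; split.
  have := @sub_morphim_pre _ _ _ (Gbar_proj_morphism (R i)) (repker k) 1 (subsetT _).
  by rewrite K1 subxx => /esym.
have cK (j : 'I_(nreps R)) : (#|repker j| * #|G|)%N = #|[set: Gbar G]|.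
  rewrite -[#|G|]cardsT -(morphim_projT (R j)) card_morphim setIid.
  by rewrite Lagrange ?subsetT.
rewrite -(leq_pmul2r (cardG_gt0 [set: G])) cardsT.
by rewrite [leqLHS]cK [leqRHS]cK.
Qed.

(** Induction on [s], intersecting [K] with one more kernel each time; a trivial image would make
    [G] abelian. *)
Lemma normal_sub_repker (i : 'I_(nreps R)) (s : seq 'I_(nreps R)) : i \notin s ->
  exists K : {group Gbar G}, [/\ K <| [set: Gbar G],
    {in s, forall k, K \subset repker k} &
    Gbar_proj_morphism (R i) @* K = [set: G]].
Proof.
elim: s => [_ | k s IHs].
  by exists [group of [set: Gbar G]]; rewrite normal_refl; split=> //; apply: morphim_projT.
rewrite inE negb_or eq_sym => /andP[neki /IHs[K [nK sK imK]]].
exists (repker k :&: K)%G; have nkK : repker k :&: K <| [set: Gbar G].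
  by rewrite normalI ?ker_normal.
split=> // [j|]; first rewrite inE => /predU1P[-> | /sK]; rewrite ?subsetIl //.
  exact/subset_trans/subsetIr.
have nKI : Gbar_proj_morphism (R i) @* (repker k :&: K) <| [set: G].
  by rewrite -(morphim_projT (R i)) morphim_normal.
case: (normal_simpleT _ nKI) => // I1; case/negP: nabG.
(* The commutators of the two normal subgroups lie in their intersection. *)
rewrite /abelian -{1}(morphim_repker i k neki) -imK; apply/commG1P/trivgP.
rewrite /= -morphimR ?subsetT // -I1 morphimS // subsetI commg_subl commg_subr.
apply/andP; split; last exact: subset_trans (subsetT _) (normal_norm nK).
exact: subset_trans (subsetT _) (ker_norm _).
Qed.

(** As in the Chinese remainder theorem, each new coordinate is corrected by an element of the
    kernels already treated. *)
Lemma Gbar_proj_joint_surj (z : 'I_(nreps R) -> G) :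
  exists u, forall i, Gbar_proj (R i) u = z i.
Proof.
have H s : uniq s -> exists u, {in s, forall i, Gbar_proj (R i) u = z i}.
  elim: s => [_ | k s IHs /= /andP[ks /IHs[u uz]]]; first by exists 1.
  have: (Gbar_proj (R k) u)^-1 * z k \in [set: G] by rewrite inE.
  have [K [_ sK <-]] := normal_sub_repker k s ks; case/morphimP=> v _ vK vE.
  exists (u * v) => i; rewrite inE Gbar_proj_morph ?inE // => /predU1P[-> | si].
    by rewrite -[Gbar_proj _ v]vE mulKVg.
  have /eqP-> : Gbar_proj (R i) v == 1 by rewrite -mem_repker (subsetP (sK i si)).
  by rewrite mulg1 uz.
have [u uz] := H _ (enum_uniq 'I_(nreps R)).
by exists u => i; rewrite uz ?mem_enum.
Qed.

Lemma ker_Pc_perm : 'ker (Pc_perm R) = Inn (Gbar G).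
Proof.
apply/eqP; rewrite eqEsubset Inn_ker_Pc_perm andbT; apply/subsetP => phi phiK.
have phiA : phi \in Aut [set: Gbar G] := dom_ker phiK.
have zP i : exists z, forall u, Gbar_proj (R i) (phi^-1 u) = Gbar_proj (R i) u ^ z.
  have := congr1 (fun s : {perm Pc G} => s (pcl (R i))) (mker phiK).
  rewrite /= (Pc_perm_pcl _ _ phiA) perm1 => /esym/pcl_eqP[z zE].
  by exists z => u; rewrite -zE Gbar_proj_twist.
have [z zE] := boolp.choice zP; have [u uz] := Gbar_proj_joint_surj z.
(* The action precomposes with [phi^-1], so it is this inverse that equals conjugation by the glued
   element [u]. *)
rewrite -groupV; apply/InnP; exists u => v; apply: (rep_separate R) => i.
by rewrite zE Gbar_proj_conj uz.
Qed.

Lemma Pc_perm_lift (s : {perm Pc G}) :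
    (forall a c, a \in Aut [set: G] ->
      s (out_act (coset (Inn G) a) c) = out_act (coset (Inn G) a) (s c)) ->
  exists2 phi, phi \in Aut [set: Gbar G] & s = Pc_perm R phi.
Proof.
move=> sOut; pose q i := qrepr (s (pcl (R i))).
have qE i a : a \in Aut [set: G] ->
    s (pcl (autPair a (R i))) = pcl (autPair a (q i)).
  by move=> aA; rewrite -!out_actE // sOut // /q pclK.
(* Pulling back along [s^-1] shows that the [q i] again reach every class up to [Aut G]; this makes
   [psi] injective. *)
have q_all p : exists i, exists2 a, a \in Aut [set: G] &
    pcl p = pcl (autPair a (q i)).
  have [i [a aA sp]] := repP_pcl R (qrepr (s^-1 (pcl p))).
  by exists i, a => //; rewrite -qE // -sp pclK permKV.
have [psi psiE] :=
  boolp.choice (fun u => Gbar_proj_joint_surj (fun i => Gbar_proj (q i) u)).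
have psi_inj : injective psi.
  by move=> u v euv; apply: (Gbar_proj_separate _ _ q q_all) => i; rewrite -!psiE euv.
have psiA : perm psi_inj \in Aut [set: Gbar G].
  rewrite AutT; apply/'forall_'forall_eqP => u v; rewrite !permE.
  by apply: (rep_separate R) => i; rewrite Gbar_proj_morph ?inE // !psiE Gbar_proj_morph ?inE.
(* [twist] inverts its automorphism, so the inverse of [psi] is what turns [R i] into [q i]. *)
have phiA := groupVr psiA; exists (perm psi_inj)^-1 => //.
have tE i : twist phiA (R i) = q i.
  by apply: val_inj; rewrite /= invgK !permE !psiE projx projy -gpE.
apply/permP => c; rewrite -[c]pclK; have [i [a aA ->]] := repP_pcl R (qrepr c).
by rewrite (Pc_perm_pcl _ _ phiA) twist_autPair // tE qE.
Qed.

Lemma class_gxP u :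
  reflect (forall i, Gbar_proj (R i) u \in pfst (R i) ^: [set: G])
          (u \in gx G ^: [set: Gbar G]).
Proof.
apply: (iffP imsetP) => [[v _ ->] i | uz].
  by rewrite Gbar_proj_conj projx memJ_class ?inE.
have zP i : exists z, Gbar_proj (R i) u = pfst (R i) ^ z.
  by have /imsetP[z _ ->] := uz i; exists z.
have [z zE] := boolp.choice zP; have [v vz] := Gbar_proj_joint_surj z.
exists v; rewrite ?inE //; apply: (rep_separate R) => i.
by rewrite Gbar_proj_conj projx vz zE.
Qed.

End Simple.

(** Conditions phrased as commutation of permutations can be transported along [Pc_perm]. *)
Lemma mem_SG (G : finGroupType) (R : orbitReps G) (s : {perm Pc G}) :
  reflect [/\ forall a c, a \in Aut [set: G] ->
                s (out_act (coset (Inn G) a) c) = out_act (coset (Inn G) a) (s c),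
              commute s (Pc_perm R (theta G)), commute s (Pc_perm R (delta G)) &
              forall c, Pc_rel (s c) c]
          (s \in SG R).
Proof.
have [tA _ _] := thetaP G; have [dA _ _] := deltaP G.
have comP phi : phi \in Aut [set: Gbar G] ->
    reflect (commute s (Pc_perm R phi)) [forall c, s (Pc_act R phi c) == Pc_act R phi (s c)].
  move=> phiA; apply: (iffP 'forall_eqP) => [e | /permP e c].
    by apply/permP => c; rewrite !permM !Pc_permE.
  by have := e c; rewrite !permM !Pc_permE.
rewrite inE; apply: (iffP and4P) => [[] | [h1 h2 h3 h4]].
  move=> /'forall_in_'forall_eqP h1 /(comP _ tA) h2 /(comP _ dA) h3 /forallP h4.
  by split=> // a c aA; apply: h1; apply: mem_quotient.
split; last exact/forallP; last 2 first.
- exact/comP.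
- exact/comP.
apply/'forall_in_'forall_eqP => _ /morphimP[a _ aA ->] c; exact: h1.
Qed.

(** * Passage to outer automorphisms *)

Section OutAction.
Context {G : finGroupType} (R : orbitReps G).

Lemma ker_coset_Pc_perm :
  'ker (coset (Inn (Gbar G))) \subset 'ker (Pc_perm R).
Proof. by rewrite ker_coset Inn_ker_Pc_perm. Qed.

Definition Out_perm :=
  factm ker_coset_Pc_perm (normal_norm (Inn_normal (Gbar G))).
Canonical Out_perm_morphism := [morphism of Out_perm].

Lemma Out_permE phi : phi \in Aut [set: Gbar G] ->
  Out_perm (coset (Inn (Gbar G)) phi) = Pc_perm R phi.
Proof. by move=> phiA; rewrite /Out_perm factmE. Qed.

Hypotheses (simpleG : simple [set: G]) (nabG : ~~ abelian [set: G]).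

Lemma injm_Out_perm : 'injm Out_perm.
Proof.
by apply/injm_factmP; rewrite ker_coset; apply: ker_Pc_perm.
Qed.

(** Commutation can be tested on [Pc] because [Out (Gbar G)] acts faithfully. *)
Lemma commute_coset_Inn phi psi :
    phi \in Aut [set: Gbar G] -> psi \in Aut [set: Gbar G] ->
  reflect (commute (Pc_perm R phi) (Pc_perm R psi))
    (coset (Inn (Gbar G)) phi \in 'C[coset (Inn (Gbar G)) psi]).
Proof.
move=> phiA psiA.
have phiO : coset (Inn (Gbar G)) phi \in Out (Gbar G) by apply: mem_quotient.
have psiO : coset (Inn (Gbar G)) psi \in Out (Gbar G) by apply: mem_quotient.
rewrite -!Out_permE // /commute; apply: (iffP cent1P); rewrite /commute => e.
  by rewrite -!(morphM Out_perm_morphism) // e.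
by apply: (injmP injm_Out_perm); rewrite ?groupM // !(morphM Out_perm_morphism).
Qed.

Lemma mem_GT1_aut phi : phi \in Aut [set: Gbar G] ->
  (phi \in GT1_aut G) = (Pc_perm R phi \in SG R).
Proof.
move=> phiA; have [tA tx ty] := thetaP G; have [dA _ _] := deltaP G.
(* [GT1_aut] constrains [phi], whereas the action on pairs involves [phi^-1]. *)
have phiV : (phi (gx G) \in gx G ^: [set: Gbar G]) =
            (phi^-1 (gx G) \in gx G ^: [set: Gbar G]).
  apply/imsetP/imsetP => -[v _ vE].
    exists (phi^-1 v^-1); rewrite ?inE //.
    rewrite -{2}(permK phi (gx G)) vE -[RHS]/(_^-1 * _) -!(AutV (groupVr phiA)).
    by rewrite -!(AutM (groupVr phiA)) -[X in _ = phi^-1 X]/(_ ^ _) conjgK.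
  exists (phi v^-1); rewrite ?inE //.
  rewrite -{2}(permKV phi (gx G)) vE -[RHS]/(_^-1 * _) -!(AutV phiA).
  by rewrite -!(AutM phiA) -[X in _ = phi X]/(_ ^ _) conjgK.
rewrite inE phiA phiV /=; apply/and3P/mem_SG.
  case=> xC /(commute_coset_Inn _ _ phiA tA) Ct /(commute_coset_Inn _ _ phiA dA) Cd.
  split=> // [a c aA | c]; first exact: Pc_perm_Out.
  rewrite -[c]pclK (Pc_perm_pcl _ _ phiA) Pc_relE.
  set p := qrepr c; case/imsetP: xC => v _ vE.
  have xC q : Gbar_proj q (phi^-1 (gx G)) \in pfst q ^: [set: G].
    by rewrite vE Gbar_proj_conj projx memJ_class ?inE.
  apply/andP; split; first exact: xC.
  (* [twist tA p] has first coordinate [psnd p], so [xC] for this pair, combined with commutation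
     with [theta], settles the second coordinate. *)
  have := congr1 (fun s : {perm Pc G} => s (pcl p)) Ct.
  rewrite /= !permM !(Pc_perm_pcl _ _ phiA, Pc_perm_pcl _ _ tA) => /pcl_eqP[z zE].
  have := xC (twist tA p); rewrite -(Gbar_proj_twist phiA) zE.
  rewrite !Gbar_proj_twist -{1}ty permK -(projx (twist tA p)) Gbar_proj_twist -{1}ty permK projy.
  by rewrite class_sym classGidl ?inE // class_sym.
case=> _ Ct Cd rel; split; [|exact/commute_coset_Inn|exact/commute_coset_Inn].
apply/(class_gxP R) => // i; have := rel (pcl (R i)).
by rewrite (Pc_perm_pcl _ _ phiA) Pc_relE => /andP[].
Qed.

End OutAction.

Theorem theorem4p9 (G : finGroupType) (simpleG : simple [set: G])
    (nabG : ~~ abelian [set: G]) (R : orbitReps G) :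
  exists f : {morphism GT1 G >-> {perm Pc G}},
    (forall phi : {perm Gbar G}, phi \in GT1_aut G ->
       forall c : Pc G, f (coset (Inn (Gbar G)) phi) c = Pc_act R phi c) /\
    isom (GT1 G) (SG R) f.
Proof.
have sGT1 : GT1_aut G \subset Aut [set: Gbar G].
  by apply/subsetP => phi; rewrite inE => /andP[].
have sOut : GT1 G \subset Out (Gbar G) by apply: quotientS.
exists (restrm_morphism sOut (Out_perm_morphism R)); split=> [phi phiGT c|].
  have phiA := subsetP sGT1 _ phiGT.
  by rewrite /= /restrm /= Out_permE // Pc_permE.
apply/isomP; split; first exact/injm_restrm/injm_Out_perm.
rewrite im_restrm /= morphim_factm; apply/setP => s.
apply/morphimP/idP => [[phi phiA phiGT ->] | sS]; first by rewrite -mem_GT1_aut.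
(* Surjectivity: equivariance under [Out G] gives a lift to [Aut], and [mem_GT1_aut] places it in
   [GT1_aut]. *)
have [sC _ _ _] := mem_SG G R s sS.
have [phi phiA sE] := Pc_perm_lift R simpleG nabG s sC.
by exists phi => //; rewrite (mem_GT1_aut R) // -sE.
Qed.
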